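(* Let $\mathbb{X}$ be a real reflexive Kadets-Klee Banach space and $\mathbb{Y}$ a real Fréchet differentiable normed linear space. Let $T\in\mathbb{K}(\mathbb{X},\mathbb{Y})$ with $\|T\|=1$. Then the operator norm of $\mathbb{B}(\mathbb{X},\mathbb{Y})$ is Gâteaux differentiable at $T$ if and only if it is Fréchet differentiable at $T$.
   Context: $\mathbb{B}(\mathbb{X},\mathbb{Y})$ carries the usual operator norm and $\mathbb{K}(\mathbb{X},\mathbb{Y})$ denotes the compact operators. For a normed space $\mathbb{Z}$ and $z_0\in\mathbb{Z}$ with $\|z_0\|=1$: the norm is Gâteaux differentiable at $z_0$ if $\lim_{h\to0}\frac{\|z_0+hy\|-\|z_0\|}{h}$ exists for every $y\in\mathbb{Z}$; it is Fréchet differentiable at $z_0$ if this limit exists uniformly in $y$ in the unit sphere of $\mathbb{Z}$. $\mathbb{Z}$ is Fréchet differentiable if its norm is Fréchet differentiable at every point of its unit sphere. A normed space $\mathbb{X}$ is Kadets-Klee if whenever $x_n\to x$ weakly and $\|x_n\|\to\|x\|$, then $\|x_n-x\|\to0$. *)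

(* Defs.v *)
From Stdlib Require Import Reals ClassicalEpsilon.
Open Scope R_scope.

Record NormedSpace := mkNormedSpace {
  ns_car :> Type;
  ns_zero : ns_car;
  ns_add : ns_car -> ns_car -> ns_car;
  ns_opp : ns_car -> ns_car;
  ns_scal : R -> ns_car -> ns_car;
  ns_norm : ns_car -> R;
  ns_add_assoc : forall x y z, ns_add x (ns_add y z) = ns_add (ns_add x y) z;
  ns_add_comm : forall x y, ns_add x y = ns_add y x;
  ns_add_zero : forall x, ns_add ns_zero x = x;
  ns_add_opp : forall x, ns_add x (ns_opp x) = ns_zero;
  ns_scal_assoc : forall a b x, ns_scal a (ns_scal b x) = ns_scal (a * b) x;
  ns_scal_one : forall x, ns_scal 1 x = x;
  ns_scal_distr_l : forall a x y, ns_scal a (ns_add x y) = ns_add (ns_scal a x) (ns_scal a y);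
  ns_scal_distr_r : forall a b x, ns_scal (a + b) x = ns_add (ns_scal a x) (ns_scal b x);
  ns_norm_eq0 : forall x, ns_norm x = 0 -> x = ns_zero;
  ns_norm_scal : forall a x, ns_norm (ns_scal a x) = Rabs a * ns_norm x;
  ns_norm_triangle : forall x y, ns_norm (ns_add x y) <= ns_norm x + ns_norm y
}.

Arguments ns_zero {_}.
Arguments ns_add {_} _ _.
Arguments ns_opp {_} _.
Arguments ns_scal {_} _ _.
Arguments ns_norm {_} _.

Definition ns_sub {X : NormedSpace} (x y : X) : X := ns_add x (ns_opp y).

Definition sup_of (S : R -> Prop) : R :=
  epsilon (inhabits 0) (fun r => is_lub S r).

Definition is_linear {X Y : NormedSpace} (f : X -> Y) : Prop :=
  (forall x y, f (ns_add x y) = ns_add (f x) (f y)) /\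
  (forall a x, f (ns_scal a x) = ns_scal a (f x)).

Definition is_bounded {X Y : NormedSpace} (f : X -> Y) : Prop :=
  exists M, forall x, ns_norm (f x) <= M * ns_norm x.

Definition bounded_linear {X Y : NormedSpace} (f : X -> Y) : Prop :=
  is_linear f /\ is_bounded f.

Definition opnorm {X Y : NormedSpace} (f : X -> Y) : R :=
  sup_of (fun t => exists x, ns_norm x <= 1 /\ t = ns_norm (f x)).

Definition op_add {X Y : NormedSpace} (f g : X -> Y) : X -> Y :=
  fun x => ns_add (f x) (g x).
Definition op_scal {X Y : NormedSpace} (a : R) (f : X -> Y) : X -> Y :=
  fun x => ns_scal a (f x).

Definition dual_elt {X : NormedSpace} (f : X -> R) : Prop :=
  (forall x y, f (ns_add x y) = f x + f y) /\
  (forall a x, f (ns_scal a x) = a * f x) /\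
  (exists M, forall x, Rabs (f x) <= M * ns_norm x).

Definition dualnorm {X : NormedSpace} (f : X -> R) : R :=
  sup_of (fun t => exists x, ns_norm x <= 1 /\ t = Rabs (f x)).

Definition reflexive (X : NormedSpace) : Prop :=
  forall Phi : (X -> R) -> R,
    (forall f g, dual_elt f -> dual_elt g ->
        Phi (fun x => f x + g x) = Phi f + Phi g) ->
    (forall a f, dual_elt f -> Phi (fun x => a * f x) = a * Phi f) ->
    (exists M, forall f, dual_elt f -> Rabs (Phi f) <= M * dualnorm f) ->
    exists x : X, forall f, dual_elt f -> Phi f = f x.

Definition ns_cauchy {X : NormedSpace} (u : nat -> X) : Prop :=
  forall eps, 0 < eps -> exists N, forall n m, (n >= N)%nat -> (m >= N)%nat ->
    ns_norm (ns_sub (u n) (u m)) < eps.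

Definition ns_cv {X : NormedSpace} (u : nat -> X) (l : X) : Prop :=
  Un_cv (fun n => ns_norm (ns_sub (u n) l)) 0.

Definition banach (X : NormedSpace) : Prop :=
  forall u : nat -> X, ns_cauchy u -> exists l, ns_cv u l.

Definition weak_cv {X : NormedSpace} (u : nat -> X) (l : X) : Prop :=
  forall f : X -> R, dual_elt f -> Un_cv (fun n => f (u n)) (f l).

Definition kadets_klee (X : NormedSpace) : Prop :=
  forall (u : nat -> X) (l : X),
    weak_cv u l -> Un_cv (fun n => ns_norm (u n)) (ns_norm l) -> ns_cv u l.

(* compact operator: linear, bounded, and maps bounded sequences to sequences
   having a subsequence convergent in Y (image of the unit ball is relatively
   compact, sequential characterisation valid in metric spaces). *)
Definition compact_op {X Y : NormedSpace} (T : X -> Y) : Prop :=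
  bounded_linear T /\
  forall u : nat -> X, (exists M, forall n, ns_norm (u n) <= M) ->
    exists (phi : nat -> nat) (l : Y),
      (forall n, (phi n < phi (S n))%nat) /\ ns_cv (fun n => T (u (phi n))) l.

Definition gateaux_diff_at {V : Type} (P : V -> Prop) (add : V -> V -> V)
  (scal : R -> V -> V) (nrm : V -> R) (z0 : V) : Prop :=
  forall y, P y -> exists L : R, forall eps, 0 < eps -> exists delta, 0 < delta /\
    forall h, h <> 0 -> Rabs h < delta ->
      Rabs ((nrm (add z0 (scal h y)) - nrm z0) / h - L) < eps.

Definition frechet_diff_at {V : Type} (P : V -> Prop) (add : V -> V -> V)
  (scal : R -> V -> V) (nrm : V -> R) (z0 : V) : Prop :=
  exists L : V -> R, forall eps, 0 < eps -> exists delta, 0 < delta /\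
    forall y, P y -> nrm y = 1 -> forall h, h <> 0 -> Rabs h < delta ->
      Rabs ((nrm (add z0 (scal h y)) - nrm z0) / h - L y) < eps.

Definition frechet_space (Y : NormedSpace) : Prop :=
  forall z : Y, ns_norm z = 1 ->
    frechet_diff_at (fun _ => True) (@ns_add Y) (@ns_scal Y) (@ns_norm Y) z.

(* Main.v *)
(** By reflexivity and compactness [T] attains its norm at a unit vector [x0];
    Gâteaux differentiability forces every such vector to be [x0] or [- x0], since
    each of them computes the derivative of the operator norm at [T]. By the
    Kadets-Klee property, every unit-ball vector [x] with [|T x|] close to [1] is
    then close to [x0] or [- x0] in norm. With [G] the derivative of the norm of [Y]
    at [T x0], the derivative at [T] is [S |-> G (S x0)]: the line
    [1 + h G (S x0)] always bounds [|T + h S|] from below, and near-maximizers [x]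
    of [T + h S] being close to [x0] (up to sign), convexity and the uniformity of
    the derivative [G] give the matching upper bound uniformly in [S].

    Weak sequential compactness is replaced by limits along a free ultrafilter:
    since the only possible limit is known, a sequence converges weakly as soon as
    all ultrafilter limits of its subsequences agree. *)

Require Import Defs.
From Stdlib Require Import Reals Lra Lia Classical ClassicalEpsilon FunctionalExtensionality.
From mathcomp Require ssrbool ssrnat boolp classical_sets filter.
Open Scope R_scope.

(** * Vector identities and elementary norm estimates *)

Lemma ns_scal_zero_l {V : NormedSpace} (x : V) : ns_scal 0 x = ns_zero.
Proof.
  assert (E : ns_add (ns_scal 0 x) (ns_scal 0 x) = ns_scal 0 x)
    by (rewrite <- ns_scal_distr_r; f_equal; ring).
  rewrite <- (ns_add_opp V (ns_scal 0 x)). rewrite <- E at 2.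
  rewrite <- ns_add_assoc, ns_add_opp, ns_add_comm, ns_add_zero; reflexivity.
Qed.

Lemma ns_opp_scal {V : NormedSpace} (x : V) : ns_opp x = ns_scal (-1) x.
Proof.
  assert (E : ns_add x (ns_scal (-1) x) = ns_zero).
  { rewrite <- (ns_scal_one V x) at 1. rewrite <- ns_scal_distr_r.
    replace (1 + -1) with 0 by ring. apply ns_scal_zero_l. }
  rewrite <- (ns_add_zero V (ns_scal (-1) x)), <- (ns_add_opp V x).
  rewrite (ns_add_comm V x (ns_opp x)), <- ns_add_assoc, E, ns_add_comm, ns_add_zero.
  reflexivity.
Qed.

(* Syntax of linear combinations of three vectors: an identity between two of
   them follows from the equality of their coefficients. *)
Inductive vexp :=
| V1 | V2 | V3 | V0
| VAdd (e f : vexp) | VOpp (e : vexp) | VScal (a : R) (e : vexp).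

Fixpoint veval {V : NormedSpace} (x y z : V) (e : vexp) : V :=
  match e with
  | V1 => x | V2 => y | V3 => z | V0 => ns_zero
  | VAdd e f => ns_add (veval x y z e) (veval x y z f)
  | VOpp e => ns_opp (veval x y z e)
  | VScal a e => ns_scal a (veval x y z e)
  end.

Fixpoint vcoef (p q r : R) (e : vexp) : R :=
  match e with
  | V1 => p | V2 => q | V3 => r | V0 => 0
  | VAdd e f => vcoef p q r e + vcoef p q r f
  | VOpp e => - vcoef p q r e
  | VScal a e => a * vcoef p q r e
  end.

Definition vcomb {V : NormedSpace} (a b c : R) (x y z : V) : V :=
  ns_add (ns_scal a x) (ns_add (ns_scal b y) (ns_scal c z)).

Lemma vcomb_add {V : NormedSpace} (a b c a' b' c' : R) (x y z : V) :
  ns_add (vcomb a b c x y z) (vcomb a' b' c' x y z) =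
  vcomb (a + a') (b + b') (c + c') x y z.
Proof.
  unfold vcomb. rewrite !ns_scal_distr_r.
  assert (E : forall p q r s : V,
    ns_add (ns_add p q) (ns_add r s) = ns_add (ns_add p r) (ns_add q s)).
  { intros p q r s. rewrite <- !ns_add_assoc. f_equal.
    rewrite !ns_add_assoc. f_equal. apply ns_add_comm. }
  rewrite E. f_equal. apply E.
Qed.

Lemma vcomb_scal {V : NormedSpace} (k a b c : R) (x y z : V) :
  ns_scal k (vcomb a b c x y z) = vcomb (k * a) (k * b) (k * c) x y z.
Proof.
  unfold vcomb. rewrite !ns_scal_distr_l, !ns_scal_assoc. reflexivity.
Qed.

Lemma veval_vcomb {V : NormedSpace} (x y z : V) (e : vexp) :
  veval x y z e = vcomb (vcoef 1 0 0 e) (vcoef 0 1 0 e) (vcoef 0 0 1 e) x y z.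
Proof.
  induction e as [| | | |e IHe f IHf|e IHe|a e IHe]; simpl;
    try (unfold vcomb; rewrite ?ns_scal_one, ?ns_scal_zero_l, ?ns_add_zero;
         rewrite ?(ns_add_comm _ _ ns_zero), ?ns_add_zero; reflexivity).
  - rewrite IHe, IHf. apply vcomb_add.
  - rewrite IHe, ns_opp_scal, vcomb_scal. f_equal; ring.
  - rewrite IHe. apply vcomb_scal.
Qed.

Lemma veval_eq {V : NormedSpace} (x y z : V) (e f : vexp) :
  vcoef 1 0 0 e = vcoef 1 0 0 f -> vcoef 0 1 0 e = vcoef 0 1 0 f ->
  vcoef 0 0 1 e = vcoef 0 0 1 f -> veval x y z e = veval x y z f.
Proof.
  intros H1 H2 H3. rewrite !veval_vcomb, H1, H2, H3. reflexivity.
Qed.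

Ltac vquote x y z t :=
  lazymatch t with
  | x => constr:(V1)
  | y => constr:(V2)
  | z => constr:(V3)
  | ns_zero => constr:(V0)
  | ns_add ?a ?b =>
      let e := vquote x y z a in let f := vquote x y z b in constr:(VAdd e f)
  | ns_opp ?a => let e := vquote x y z a in constr:(VOpp e)
  | ns_scal ?k ?a => let e := vquote x y z a in constr:(VScal k e)
  end.

(** Atoms are tried in order, so an argument is repeated when fewer than three vectors occur. *)
Ltac vec x y z :=
  unfold ns_sub;
  lazymatch goal with
  | |- ?a = ?b =>
      let e := vquote x y z a in let f := vquote x y z b in
      change (veval x y z e = veval x y z f);
      apply veval_eq; simpl; try field; auto
  end.

Lemma ns_norm_zero {V : NormedSpace} : ns_norm (@ns_zero V) = 0.
Proof.
  rewrite <- (ns_scal_zero_l ns_zero), ns_norm_scal, Rabs_R0. ring.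
Qed.

Lemma ns_norm_opp {V : NormedSpace} (x : V) : ns_norm (ns_opp x) = ns_norm x.
Proof.
  rewrite ns_opp_scal, ns_norm_scal, Rabs_left by lra. ring.
Qed.

Lemma ns_norm_nonneg {V : NormedSpace} (x : V) : 0 <= ns_norm x.
Proof.
  pose proof (ns_norm_triangle V x (ns_opp x)) as H.
  rewrite ns_add_opp, ns_norm_zero, ns_norm_opp in H. lra.
Qed.

Lemma ns_sub_eq0 {V : NormedSpace} (x y : V) : ns_norm (ns_sub x y) = 0 -> x = y.
Proof.
  intros H. apply ns_norm_eq0 in H.
  replace x with (ns_add y (ns_sub x y)) by vec x y y.
  rewrite H. vec x y y.
Qed.

Lemma ns_norm_le_add_sub {V : NormedSpace} (x y : V) :
  ns_norm x <= ns_norm y + ns_norm (ns_sub x y).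
Proof.
  replace x with (ns_add y (ns_sub x y)) at 1 by vec x y y. apply ns_norm_triangle.
Qed.

Lemma ns_norm_sub_sym {V : NormedSpace} (x y : V) :
  ns_norm (ns_sub x y) = ns_norm (ns_sub y x).
Proof.
  rewrite <- ns_norm_opp. f_equal. vec x y y.
Qed.

Lemma linear_sub {X Y : NormedSpace} (f : X -> Y) (x y : X) :
  is_linear f -> f (ns_sub x y) = ns_sub (f x) (f y).
Proof.
  intros [Ha Hs]. unfold ns_sub. rewrite Ha, !ns_opp_scal, Hs. reflexivity.
Qed.

Lemma dual_sub {X : NormedSpace} (f : X -> R) (x y : X) :
  dual_elt f -> f (ns_sub x y) = f x - f y.
Proof.
  intros [Ha [Hs _]]. unfold ns_sub. rewrite Ha, ns_opp_scal, Hs. ring.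
Qed.

(** * The Hahn-Banach theorem *)

Definition is_glb (S : R -> Prop) (m : R) : Prop :=
  (forall r, S r -> m <= r) /\ (forall c, (forall r, S r -> c <= r) -> c <= m).

Definition inf_of (S : R -> Prop) : R := epsilon (inhabits 0) (is_glb S).

Lemma inf_of_glb (S : R -> Prop) (m r0 : R) :
  S r0 -> (forall r, S r -> m <= r) -> is_glb S (inf_of S).
Proof.
  intros H0 Hm. unfold inf_of. apply epsilon_spec.
  destruct (completeness (fun t => S (- t))) as [l [Hu Hl]].
  - exists (- m). intros t Ht. apply Hm in Ht. lra.
  - exists (- r0). rewrite Ropp_involutive. exact H0.
  - exists (- l). split.
    + intros r Hr. assert (- r <= l); [|lra]. apply Hu. cbv beta.
      rewrite Ropp_involutive. exact Hr.
    + intros c Hc. specialize (Hl (- c)).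
      assert (l <= - c); [|lra]. apply Hl. intros t Ht. apply Hc in Ht. lra.
Qed.

(** Lets homogeneity pass to functionals defined by infima. For [a = 0], where division by [a]
    fails, any element of [S] still yields [c <= 0]. *)
Lemma le_scaled_glb (S : R -> Prop) (m a c : R) :
  is_glb S m -> 0 <= a -> (exists r, S r) -> (forall r, S r -> c <= a * r) ->
  c <= a * m.
Proof.
  intros [_ Hm] Ha [r0 Hr0] Hc. destruct (Req_dec a 0) as [->|Hn].
  - specialize (Hc r0 Hr0). lra.
  - assert (H : c / a <= m).
    { apply Hm. intros r Hr. apply (Rmult_le_reg_l a); [lra|].
      replace (a * (c / a)) with c by (field; exact Hn). auto. }
    apply (Rmult_le_compat_l a) in H; [|exact Ha].
    replace (a * (c / a)) with c in H by (field; exact Hn). exact H.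
Qed.

(** Homogeneity is stated as an inequality, which is easier to verify for infima; applying it to
    [/ a] as well gives equality for [a > 0]. *)
Definition sublinear {X : NormedSpace} (q : X -> R) : Prop :=
  (forall x y, q (ns_add x y) <= q x + q y) /\
  (forall a x, 0 <= a -> q (ns_scal a x) <= a * q x).

Lemma sublinear_norm (X : NormedSpace) : sublinear (@ns_norm X).
Proof.
  split; [apply ns_norm_triangle|].
  intros a x Ha. rewrite ns_norm_scal, Rabs_pos_eq by exact Ha. lra.
Qed.

(** Follows from [0 = q (x - x) <= q x + q (- x)]. It is the lower bound that keeps infima over
    chains finite. *)
Lemma sublinear_opp {X : NormedSpace} (q : X -> R) (x : X) :
  sublinear q -> - q (ns_opp x) <= q x.
Proof.
  intros [Ha Hs].
  assert (H0 : q ns_zero = 0).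
  { apply Rle_antisym.
    - rewrite <- (ns_scal_zero_l ns_zero). eapply Rle_trans; [apply Hs; lra|lra].
    - specialize (Ha ns_zero ns_zero). rewrite ns_add_zero in Ha. lra. }
  specialize (Ha x (ns_opp x)). rewrite ns_add_opp in Ha. lra.
Qed.

Definition shift_set {X : NormedSpace} (q : X -> R) (y x : X) (r : R) : Prop :=
  exists t, 0 <= t /\ r = q (ns_add x (ns_scal t y)) - t * q y.

(* The largest sublinear functional below [q] taking the value [- q y] at [- y]. *)
Definition shift {X : NormedSpace} (q : X -> R) (y x : X) : R :=
  inf_of (shift_set q y x).

(** The set is bounded below by [- q (ns_opp x)], because [t * q y <= q (t y) <= q (x + t y) + q (-
    x)]. *)
Lemma shift_glb {X : NormedSpace} (q : X -> R) (y x : X) :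
  sublinear q -> is_glb (shift_set q y x) (shift q y x).
Proof.
  intros Hq. apply (inf_of_glb _ (- q (ns_opp x)) (q (ns_add x (ns_scal 0 y)) - 0 * q y)).
  - exists 0. split; [lra|reflexivity].
  - intros r [t [Ht ->]]. destruct Hq as [Ha Hs].
    (* The converse of the homogeneity inequality, obtained by applying the latter to [/ t] and
       [ns_scal t y]. *)
    assert (Hsy : t * q y <= q (ns_scal t y)).
    { destruct (Req_dec t 0) as [->|Hn].
      - rewrite ns_scal_zero_l. pose proof (Ha ns_zero ns_zero) as H.
        rewrite ns_add_zero in H. lra.
      - assert (H : q (ns_scal (/ t) (ns_scal t y)) <= / t * q (ns_scal t y)).
        { apply Hs. left. apply Rinv_0_lt_compat. lra. }
        rewrite ns_scal_assoc, Rinv_l, ns_scal_one in H by exact Hn.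
        apply (Rmult_le_compat_l t) in H; [|lra].
        rewrite <- Rmult_assoc, Rinv_r in H by exact Hn. lra. }
    pose proof (Ha (ns_add x (ns_scal t y)) (ns_opp x)) as H.
    replace (ns_add (ns_add x (ns_scal t y)) (ns_opp x)) with (ns_scal t y) in H
      by vec x y y.
    lra.
Qed.

Lemma shift_le_value {X : NormedSpace} (q : X -> R) (y x : X) (t : R) :
  sublinear q -> 0 <= t -> shift q y x <= q (ns_add x (ns_scal t y)) - t * q y.
Proof.
  intros Hq Ht. apply (shift_glb q y x Hq). exists t; auto.
Qed.

Lemma shift_le {X : NormedSpace} (q : X -> R) (y x : X) :
  sublinear q -> shift q y x <= q x.
Proof.
  intros Hq. pose proof (shift_le_value q y x 0 Hq (Rle_refl 0)) as H.
  replace (ns_add x (ns_scal 0 y)) with x in H by vec x y y. lra.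
Qed.

(** The values for [x] at parameter [s] and for [x'] at [t] add up to at least the value for their
    sum at [s + t]; scaling by [a] turns the parameter [t] into [a * t]. *)
Lemma sublinear_shift {X : NormedSpace} (q : X -> R) (y : X) :
  sublinear q -> sublinear (shift q y).
Proof.
  intros Hq. destruct (Hq) as [Ha Hs]. split.
  - intros x x'.
    assert (shift q y (ns_add x x') - shift q y x' <= shift q y x); [|lra].
    apply (shift_glb q y x Hq). intros r [s [Hs0 ->]].
    set (r := q (ns_add x (ns_scal s y)) - s * q y).
    assert (shift q y (ns_add x x') - r <= shift q y x'); [|lra].
    apply (shift_glb q y x' Hq). intros r' [t [Ht0 ->]]. unfold r.
    pose proof (shift_le_value q y (ns_add x x') (s + t) Hq ltac:(lra)) as H.
    pose proof (Ha (ns_add x (ns_scal s y)) (ns_add x' (ns_scal t y))) as H'.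
    replace (ns_add (ns_add x (ns_scal s y)) (ns_add x' (ns_scal t y)))
      with (ns_add (ns_add x x') (ns_scal (s + t) y)) in H' by vec x x' y.
    lra.
  - intros a x Ha0.
    assert (Hv : forall t, 0 <= t ->
      shift q y (ns_scal a x) <= a * (q (ns_add x (ns_scal t y)) - t * q y)).
    { intros t Ht.
      pose proof (shift_le_value q y (ns_scal a x) (a * t) Hq
                    (Rmult_le_pos _ _ Ha0 Ht)) as H.
      replace (ns_add (ns_scal a x) (ns_scal (a * t) y))
        with (ns_scal a (ns_add x (ns_scal t y))) in H by vec x y y.
      pose proof (Hs a (ns_add x (ns_scal t y)) Ha0). lra. }
    apply (le_scaled_glb (shift_set q y x)); [apply shift_glb, Hq|exact Ha0| |].
    + exists (q (ns_add x (ns_scal 0 y)) - 0 * q y), 0. split; [lra|reflexivity].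
    + intros r [t [Ht ->]]. auto.
Qed.

(** Zorn's lemma for the reversed preorder. The point of [U] that [ZL_preorder] asks for exists
    because the empty chain has a lower bound. *)
Lemma zorn_minimal {U : Type} (le : U -> U -> Prop) :
  (forall s, le s s) -> (forall r s t, le r s -> le s t -> le r t) ->
  (forall A : U -> Prop, (forall s t, A s -> A t -> le s t \/ le t s) ->
     exists t, forall s, A s -> le t s) ->
  exists t, forall s, le s t -> le t s.
Proof.
  intros Hr Ht Hc.
  destruct (classic (inhabited U)) as [[u]|Hn].
  - destruct (@classical_sets.ZL_preorder U u (fun s t => boolp.asbool (le t s)))
      as [t Hmin].
    + intros t. rewrite boolp.asboolE. apply Hr.
    + intros r s t. rewrite !boolp.asboolE. intros H1 H2. exact (Ht _ _ _ H2 H1).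
    + intros A HA. destruct (Hc A) as [t Hlow].
      * intros s t Hs Ht'. specialize (HA s t Hs Ht'). cbv beta in HA.
        rewrite !boolp.asboolE in HA. tauto.
      * exists t. intros s Hs. rewrite boolp.asboolE. auto.
    + exists t. intros s Hs. specialize (Hmin s). cbv beta in Hmin.
      rewrite !boolp.asboolE in Hmin. auto.
  - destruct (Hc (fun _ => False)) as [t _]; [contradiction|].
    exfalso. apply Hn. constructor. exact t.
Qed.

(** The witness is the pointwise infimum; its subadditivity rests on the total order of the
    chain. *)
Lemma chain_inf {X : NormedSpace} (p : X -> R) (A : (X -> R) -> Prop) :
  sublinear p ->
  (forall q, A q -> sublinear q /\ forall x, q x <= p x) ->
  (forall q q', A q -> A q' -> (forall x, q x <= q' x) \/ (forall x, q' x <= q x)) ->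
  exists m, sublinear m /\ (forall x, m x <= p x) /\
    forall q, A q -> forall x, m x <= q x.
Proof.
  intros Hp HA HC.
  (* Adjoining [p] covers the empty chain and puts the infimum below [p]. *)
  set (B := fun q => q = p \/ A q).
  assert (HB : forall q, B q -> sublinear q /\ forall x, q x <= p x).
  { intros q [->|Hq]; [split; [exact Hp|intros; lra]|auto]. }
  assert (HBC : forall q q', B q -> B q' ->
    (forall x, q x <= q' x) \/ (forall x, q' x <= q x)).
  { intros q q' [->|Hq] [->|Hq']; [left; intros; lra| | |auto].
    - right. apply HA, Hq'.
    - left. apply HA, Hq. }
  set (S := fun x r => exists q, B q /\ r = q x).
  assert (Hglb : forall x, is_glb (S x) (inf_of (S x))).
  { intros x. apply (inf_of_glb _ (- p (ns_opp x)) (p x)).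
    - exists p. split; [left|]; reflexivity.
    - intros r [q [Hq ->]]. destruct (HB q Hq) as [Hsub Hle].
      pose proof (sublinear_opp q x Hsub). specialize (Hle (ns_opp x)). lra. }
  assert (Hval : forall q x, B q -> inf_of (S x) <= q x).
  { intros q x Hq. apply Hglb. exists q; auto. }
  exists (fun x => inf_of (S x)). split; [split|split].
  - intros x y.
    assert (inf_of (S (ns_add x y)) - inf_of (S y) <= inf_of (S x)); [|lra].
    apply Hglb. intros r [q [Hq ->]].
    assert (inf_of (S (ns_add x y)) - q x <= inf_of (S y)); [|lra].
    apply Hglb. intros r' [q' [Hq' ->]].
    (* The smaller of [q] and [q'] serves at both points, and its own subadditivity applies. *)
    destruct (HBC q q' Hq Hq') as [Hle|Hle].
    + pose proof (Hval q (ns_add x y) Hq).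
      pose proof (proj1 (proj1 (HB q Hq)) x y). specialize (Hle y). lra.
    + pose proof (Hval q' (ns_add x y) Hq').
      pose proof (proj1 (proj1 (HB q' Hq')) x y). specialize (Hle x). lra.
  - intros a x Ha.
    assert (Hv : forall q, B q -> inf_of (S (ns_scal a x)) <= a * q x).
    { intros q Hq. eapply Rle_trans; [apply (Hval q _ Hq)|].
      apply (proj1 (HB q Hq)). exact Ha. }
    apply (le_scaled_glb (S x)); [apply Hglb|exact Ha| |].
    { exists (p x), p. split; [left|]; reflexivity. }
    intros r [q [Hq ->]]. auto.
  - intros x. apply Hval. left; reflexivity.
  - intros q Hq x. apply Hval. right; exact Hq.
Qed.

(* A minimal sublinear functional is linear, since it equals all its shifts. *)
Lemma hahn_banach {X : NormedSpace} (p : X -> R) :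
  sublinear p ->
  exists f : X -> R,
    (forall x y, f (ns_add x y) = f x + f y) /\
    (forall a x, f (ns_scal a x) = a * f x) /\
    (forall x, f x <= p x).
Proof.
  intros Hp.
  destruct (zorn_minimal
    (U := {q : X -> R | sublinear q /\ forall x, q x <= p x})
    (fun q q' => forall x, proj1_sig q x <= proj1_sig q' x)) as [[f [Hf Hfp]] Hmin].
  - intros; lra.
  - intros r s t H1 H2 x. specialize (H1 x). specialize (H2 x). lra.
  - intros A HA.
    destruct (chain_inf p (fun q => exists H, A (exist _ q H))) as [m [Hm [Hmp HmA]]].
    + exact Hp.
    + intros q [H _]. exact H.
    + intros q q' [H Hq] [H' Hq']. exact (HA _ _ Hq Hq').
    + exists (exist _ m (conj Hm Hmp)). intros [q H] Hq. simpl. apply HmA. eauto.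
  - simpl in Hmin.
    assert (Hadd : forall x y, f (ns_add x y) = f x + f y).
    { intros x y. apply Rle_antisym; [apply Hf|].
      assert (H : sublinear (shift f y) /\ forall x, shift f y x <= p x).
      { split; [apply sublinear_shift, Hf|]. intros z.
        eapply Rle_trans; [apply shift_le, Hf|apply Hfp]. }
      (* Minimality puts [f x] below the shift, and the parameter [1] bounds the shift by
         [f (x + y) - f y]. *)
      pose proof (Hmin (exist _ _ H) (fun z => shift_le f y z Hf) x) as Hle.
      simpl in Hle.
      pose proof (shift_le_value f y x 1 Hf ltac:(lra)) as H1.
      rewrite ns_scal_one in H1. lra. }
    assert (Hopp : forall x, f (ns_opp x) = - f x).
    { intros x. pose proof (Hadd x (ns_opp x)) as H.
      pose proof (Hadd ns_zero ns_zero) as H0.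
      rewrite ns_add_zero in H0. rewrite ns_add_opp in H. lra. }
    assert (Hpos : forall a x, 0 <= a -> f (ns_scal a x) = a * f x).
    { intros a x Ha. apply Rle_antisym; [apply Hf, Ha|].
      pose proof (proj2 Hf a (ns_opp x) Ha) as H. rewrite Hopp in H.
      replace (ns_scal a (ns_opp x)) with (ns_opp (ns_scal a x)) in H by vec x x x.
      rewrite Hopp in H. lra. }
    exists f. split; [exact Hadd|split; [|exact Hfp]].
    intros a x. destruct (Rle_dec 0 a) as [Ha|Ha]; [auto|].
    replace (ns_scal a x) with (ns_opp (ns_scal (- a) x)) by vec x x x.
    rewrite Hopp, Hpos by lra. ring.
Qed.

(** Hahn-Banach is applied to the norm shifted along [x]. This functional is at most [- ns_norm x]
    at [ns_opp x], which forces [f x] up to [ns_norm x]. *)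
Lemma norming_functional {X : NormedSpace} (x : X) :
  exists f : X -> R,
    dual_elt f /\ (forall y, Rabs (f y) <= ns_norm y) /\ f x = ns_norm x.
Proof.
  destruct (hahn_banach (shift ns_norm x)) as [f [Ha [Hs Hle]]].
  { apply sublinear_shift, sublinear_norm. }
  assert (Hn : forall y, f y <= ns_norm y).
  { intros y. eapply Rle_trans; [apply Hle|apply shift_le, sublinear_norm]. }
  assert (Ho : forall y, f (ns_opp y) = - f y).
  { intros y. rewrite ns_opp_scal, Hs. ring. }
  assert (Hb : forall y, Rabs (f y) <= ns_norm y).
  { intros y. apply Rabs_le. split; [|apply Hn].
    specialize (Hn (ns_opp y)). rewrite Ho, ns_norm_opp in Hn. lra. }
  exists f. split; [|split; [exact Hb|]].
  - split; [exact Ha|split; [exact Hs|]]. exists 1. intros y.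
    rewrite Rmult_1_l. apply Hb.
  - apply Rle_antisym; [apply Hn|].
    pose proof (Hle (ns_opp x)) as H.
    pose proof (shift_le_value ns_norm x (ns_opp x) 1 (sublinear_norm X) ltac:(lra)) as H1.
    replace (ns_add (ns_opp x) (ns_scal 1 x)) with (@ns_zero X) in H1 by vec x x x.
    rewrite ns_norm_zero in H1. rewrite Ho in H. lra.
Qed.

(** * Weak limits along an ultrafilter *)

(** [uf_tail] is the freeness: with the other clauses it makes every member infinite. *)
Record free_ultrafilter (U : (nat -> Prop) -> Prop) : Prop := {
  uf_mono : forall A B : nat -> Prop, (forall n, A n -> B n) -> U A -> U B;
  uf_and : forall A B : nat -> Prop, U A -> U B -> U (fun n => A n /\ B n);
  uf_dec : forall A : nat -> Prop, U A \/ U (fun n => ~ A n);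
  uf_false : ~ U (fun _ => False);
  uf_tail : forall N, U (fun n => (N <= n)%nat)
}.

Lemma free_ultrafilter_exists : exists U, free_ultrafilter U.
Proof.
  (* An ultrafilter refining the filter of eventual sets contains all tails. *)
  destruct (filter.ultraFilterLemma filter.eventually_filter) as [U [HU Hsub]].
  pose proof (@filter.ultra_proper _ _ HU) as HP.
  pose proof (@filter.filter_filter _ _ HP) as HF.
  exists U. split.
  - intros A B HAB HA. exact (@filter.filterS _ _ HF A B HAB HA).
  - intros A B HA HB. exact (@filter.filterI _ _ HF A B HA HB).
  - intros A. exact (filter.in_ultra_setVsetC A HU).
  - exact (@filter.filter_not_empty _ _ HP).
  - intros N. apply Hsub. exists N; [exact I|].
    intros n Hn. exact (ssrbool.elimT ssrnat.leP Hn).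
Qed.

Definition is_ulim (U : (nat -> Prop) -> Prop) (u : nat -> R) (l : R) : Prop :=
  forall eps, 0 < eps -> U (fun n => Rabs (u n - l) < eps).

Section UltrafilterLimits.

Context (U : (nat -> Prop) -> Prop) (HU : free_ultrafilter U).

Lemma uf_nonempty (A : nat -> Prop) : U A -> exists n, A n.
Proof.
  intros HA. apply NNPP. intros Hn. apply (uf_false U HU).
  apply (uf_mono U HU A); [|exact HA]. intros n An. apply Hn. eauto.
Qed.

(** The limit is the supremum of the [t] with [t <= u n] for [U]-almost all [n]; the ultrafilter
    dichotomy bounds [u n] from above near it. *)
Lemma ulim_exists (u : nat -> R) (M : R) :
  (forall n, Rabs (u n) <= M) -> exists l, is_ulim U u l.
Proof.
  intros HM.
  assert (Hlo : forall n, - M <= u n <= M).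
  { intros n. specialize (HM n). revert HM. unfold Rabs. destruct Rcase_abs; lra. }
  destruct (completeness (fun t => U (fun n => t <= u n))) as [l [Hu Hl]].
  - exists M. intros t Ht. destruct (uf_nonempty _ Ht) as [n Hn].
    specialize (Hlo n). lra.
  - exists (- M). apply (uf_mono U HU (fun n => (0 <= n)%nat)).
    + intros n _. apply Hlo.
    + apply (uf_tail U HU).
  - exists l. intros eps Heps.
    assert (H1 : U (fun n => ~ l + eps / 2 <= u n)).
    { destruct (uf_dec U HU (fun n => l + eps / 2 <= u n)) as [H|H]; [|exact H].
      specialize (Hu _ H). lra. }
    assert (H2 : exists t, l - eps / 2 < t /\ U (fun n => t <= u n)).
    { apply NNPP. intros Hn. assert (l <= l - eps / 2); [|lra].
      apply Hl. intros t Ht. apply Rnot_lt_le. intros Hlt. apply Hn. eauto. }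
    destruct H2 as [t [Ht H2]].
    apply (uf_mono U HU _ _) with (2 := uf_and U HU _ _ H1 H2).
    intros n [Ha Hb]. apply Rabs_def1; lra.
Qed.

Lemma ulim_unique (u : nat -> R) (l l' : R) :
  is_ulim U u l -> is_ulim U u l' -> l = l'.
Proof.
  intros H H'. apply NNPP. intros Hn.
  assert (Hpos : 0 < Rabs (l - l') / 2).
  { assert (0 < Rabs (l - l')) by (apply Rabs_pos_lt; lra). lra. }
  destruct (uf_nonempty _ (uf_and U HU _ _ (H _ Hpos) (H' _ Hpos))) as [n [H1 H2]].
  pose proof (Rabs_triang (u n - l') (- (u n - l))) as H3. rewrite Rabs_Ropp in H3.
  replace (u n - l' + - (u n - l)) with (l - l') in H3 by ring. lra.
Qed.

Lemma ulim_add (u v : nat -> R) (l m : R) :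
  is_ulim U u l -> is_ulim U v m -> is_ulim U (fun n => u n + v n) (l + m).
Proof.
  intros H H' eps Heps.
  apply (uf_mono U HU _ _)
    with (2 := uf_and U HU _ _ (H (eps / 2) ltac:(lra)) (H' (eps / 2) ltac:(lra))).
  intros n [H1 H2]. pose proof (Rabs_triang (u n - l) (v n - m)) as H3.
  replace (u n + v n - (l + m)) with (u n - l + (v n - m)) by ring. lra.
Qed.

Lemma ulim_scal (a : R) (u : nat -> R) (l : R) :
  is_ulim U u l -> is_ulim U (fun n => a * u n) (a * l).
Proof.
  intros H eps Heps.
  (* The added [1] keeps the divisor positive when [a = 0]. *)
  assert (Hp : 0 < Rabs a + 1) by (pose proof (Rabs_pos a); lra).
  apply (uf_mono U HU _ _) with (2 := H (eps / (Rabs a + 1)) (Rdiv_lt_0_compat _ _ Heps Hp)).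
  intros n H1. rewrite <- Rmult_minus_distr_l, Rabs_mult.
  apply (Rmult_lt_compat_l (Rabs a + 1)) in H1; [|exact Hp].
  replace ((Rabs a + 1) * (eps / (Rabs a + 1))) with eps in H1 by (field; lra).
  pose proof (Rabs_pos (u n - l)). nra.
Qed.

Lemma ulim_bound (u : nat -> R) (l a M : R) :
  is_ulim U u l -> (forall n, Rabs (u n - a) <= M) -> Rabs (l - a) <= M.
Proof.
  intros H HM. apply Rnot_lt_le. intros Hlt.
  destruct (uf_nonempty _ (H (Rabs (l - a) - M) ltac:(lra))) as [n Hn].
  specialize (HM n). pose proof (Rabs_triang (u n - a) (- (u n - l))) as H3.
  rewrite Rabs_Ropp in H3. replace (u n - a + - (u n - l)) with (l - a) in H3 by ring.
  lra.
Qed.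

Lemma ulim_away (u : nat -> R) (l a d : R) :
  is_ulim U u l -> (forall n, d <= Rabs (u n - a)) -> d <= Rabs (l - a).
Proof.
  intros H HM. apply Rnot_lt_le. intros Hlt.
  destruct (uf_nonempty _ (H (d - Rabs (l - a)) ltac:(lra))) as [n Hn].
  specialize (HM n). pose proof (Rabs_triang (u n - l) (l - a)) as H3.
  replace (u n - l + (l - a)) with (u n - a) in H3 by ring. lra.
Qed.

Lemma Un_cv_ulim (u : nat -> R) (l : R) : Un_cv u l -> is_ulim U u l.
Proof.
  intros H eps Heps. destruct (H eps Heps) as [N HN].
  apply (uf_mono U HU _ _) with (2 := uf_tail U HU N). intros n Hn. exact (HN n Hn).
Qed.

End UltrafilterLimits.

(** [sup_of] is a choice that means something only when a least upper bound exists; an element and a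
    bound secure this. *)
Lemma sup_of_lub (S : R -> Prop) (M r0 : R) :
  S r0 -> (forall r, S r -> r <= M) -> is_lub S (sup_of S).
Proof.
  intros H0 HM. unfold sup_of. apply epsilon_spec.
  destruct (completeness S) as [l Hl]; [exists M; exact HM|eauto|eauto].
Qed.

Lemma dualnorm_lub {X : NormedSpace} (f : X -> R) :
  dual_elt f -> is_lub (fun t => exists x, ns_norm x <= 1 /\ t = Rabs (f x)) (dualnorm f).
Proof.
  (* [M] can be negative when the space is zero, hence the bound [Rabs M]. *)
  intros [_ [_ [M HM]]]. apply (sup_of_lub _ (Rabs M) (Rabs (f ns_zero))).
  - exists ns_zero. rewrite ns_norm_zero. split; [lra|reflexivity].
  - intros r [x [Hx ->]]. specialize (HM x). pose proof (ns_norm_nonneg x).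
    pose proof (Rle_abs M). pose proof (Rabs_pos M). nra.
Qed.

Lemma dual_add {X : NormedSpace} (f g : X -> R) :
  dual_elt f -> dual_elt g -> dual_elt (fun x => f x + g x).
Proof.
  intros [Fa [Fs [M HM]]] [Ga [Gs [N HN]]]. split; [|split].
  - intros x y. rewrite Fa, Ga. ring.
  - intros a x. rewrite Fs, Gs. ring.
  - exists (M + N). intros x. specialize (HM x). specialize (HN x).
    pose proof (Rabs_triang (f x) (g x)). lra.
Qed.

Lemma dual_scal {X : NormedSpace} (a : R) (f : X -> R) :
  dual_elt f -> dual_elt (fun x => a * f x).
Proof.
  intros [Fa [Fs [M HM]]]. split; [|split].
  - intros x y. rewrite Fa. ring.
  - intros b x. rewrite Fs. ring.
  - exists (Rabs a * M). intros x. rewrite Rabs_mult, Rmult_assoc.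
    apply Rmult_le_compat_l; [apply Rabs_pos|apply HM].
Qed.

(* [f |-> lim_U f (u n)] is an element of the bidual. *)
Lemma weak_ulim {X : NormedSpace} (U : (nat -> Prop) -> Prop) (u : nat -> X) :
  free_ultrafilter U -> reflexive X -> (forall n, ns_norm (u n) <= 1) ->
  exists x, ns_norm x <= 1 /\ forall f, dual_elt f -> is_ulim U (fun n => f (u n)) (f x).
Proof.
  intros HU Hrefl Hu.
  (* The value may be arbitrary outside the dual; [reflexive] constrains [Phi] on dual elements
     only. *)
  set (Phi := fun f : X -> R => epsilon (inhabits 0) (is_ulim U (fun n => f (u n)))).
  assert (Hb : forall f, dual_elt f -> forall n, Rabs (f (u n)) <= dualnorm f).
  { intros f Hf n. apply (dualnorm_lub f Hf). eauto. }
  assert (HPhi : forall f, dual_elt f -> is_ulim U (fun n => f (u n)) (Phi f)).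
  { intros f Hf. unfold Phi. apply epsilon_spec.
    apply (ulim_exists U HU _ (dualnorm f)). auto. }
  destruct (Hrefl Phi) as [x Hx].
  - intros f g Hf Hg. apply (ulim_unique U HU (fun n => f (u n) + g (u n))).
    + exact (HPhi _ (dual_add f g Hf Hg)).
    + apply ulim_add; auto.
  - intros a f Hf. apply (ulim_unique U HU (fun n => a * f (u n))).
    + exact (HPhi _ (dual_scal a f Hf)).
    + apply ulim_scal; auto.
  - exists 1. intros f Hf. rewrite Rmult_1_l.
    pose proof (ulim_bound U HU _ _ 0 (dualnorm f) (HPhi f Hf)) as H.
    rewrite Rminus_0_r in H. apply H. intros n. rewrite Rminus_0_r. auto.
  - exists x. split.
    (* For a norming [f], the number [ns_norm x = f x] is a limit of values [f (u n)] in
       [[-1, 1]]. *)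
    + destruct (norming_functional x) as [f [Hf [Hfb Hfx]]].
      pose proof (ulim_bound U HU _ _ 0 1 (HPhi f Hf)) as H.
      rewrite Rminus_0_r, (Hx f Hf), Hfx in H.
      pose proof (Rle_abs (ns_norm x)).
      assert (Rabs (ns_norm x) <= 1); [|lra]. apply H.
      intros n. rewrite Rminus_0_r. eapply Rle_trans; [apply Hfb|apply Hu].
    + intros f Hf. rewrite <- (Hx f Hf). auto.
Qed.

(** * The operator norm *)

Lemma linear_zero {X Y : NormedSpace} (f : X -> Y) :
  is_linear f -> f ns_zero = ns_zero.
Proof.
  intros [_ Hs]. rewrite <- (ns_scal_zero_l ns_zero), Hs. apply ns_scal_zero_l.
Qed.

Lemma opnorm_lub {X Y : NormedSpace} (f : X -> Y) :
  bounded_linear f ->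
  is_lub (fun t => exists x, ns_norm x <= 1 /\ t = ns_norm (f x)) (opnorm f).
Proof.
  intros [_ [M HM]]. apply (sup_of_lub _ (Rabs M) (ns_norm (f ns_zero))).
  - exists ns_zero. rewrite ns_norm_zero. split; [lra|reflexivity].
  - intros r [x [Hx ->]]. specialize (HM x). pose proof (ns_norm_nonneg x).
    pose proof (Rle_abs M). pose proof (Rabs_pos M). nra.
Qed.

Lemma opnorm_ge {X Y : NormedSpace} (f : X -> Y) (x : X) :
  bounded_linear f -> ns_norm x <= 1 -> ns_norm (f x) <= opnorm f.
Proof.
  intros Hf Hx. apply (opnorm_lub f Hf). eauto.
Qed.

Lemma opnorm_le {X Y : NormedSpace} (f : X -> Y) (c : R) :
  bounded_linear f -> (forall x, ns_norm x <= 1 -> ns_norm (f x) <= c) -> opnorm f <= c.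
Proof.
  intros Hf Hc. apply (opnorm_lub f Hf). intros t [x [Hx ->]]. auto.
Qed.

Lemma opnorm_approx {X Y : NormedSpace} (f : X -> Y) (c : R) :
  bounded_linear f -> c < opnorm f -> exists x, ns_norm x <= 1 /\ c < ns_norm (f x).
Proof.
  intros Hf Hc. apply NNPP. intros Hn.
  assert (opnorm f <= c); [|lra]. apply opnorm_le; [exact Hf|].
  intros x Hx. apply Rnot_lt_le. intros Hlt. apply Hn. eauto.
Qed.

Lemma opnorm_nonneg {X Y : NormedSpace} (f : X -> Y) :
  bounded_linear f -> 0 <= opnorm f.
Proof.
  intros Hf. apply Rle_trans with (ns_norm (f ns_zero)); [apply ns_norm_nonneg|].
  apply (opnorm_ge f ns_zero Hf). rewrite ns_norm_zero. lra.
Qed.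

Lemma ns_normalize {V : NormedSpace} (x : V) :
  x <> ns_zero -> 0 < ns_norm x /\ ns_norm (ns_scal (/ ns_norm x) x) = 1.
Proof.
  intros Hx. assert (Hp : 0 < ns_norm x).
  { destruct (ns_norm_nonneg x) as [H|H]; [exact H|].
    exfalso. apply Hx, ns_norm_eq0. auto. }
  split; [exact Hp|].
  rewrite ns_norm_scal, Rabs_pos_eq by (left; apply Rinv_0_lt_compat, Hp).
  apply Rinv_l. lra.
Qed.

Lemma opnorm_mult {X Y : NormedSpace} (f : X -> Y) (x : X) :
  bounded_linear f -> ns_norm (f x) <= opnorm f * ns_norm x.
Proof.
  intros Hf. destruct (classic (x = ns_zero)) as [->|Hx].
  - rewrite linear_zero by apply Hf. rewrite !ns_norm_zero. lra.
  - destruct (ns_normalize x Hx) as [Hp H1].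
    pose proof (opnorm_ge f (ns_scal (/ ns_norm x) x) Hf ltac:(lra)) as H.
    rewrite (proj2 (proj1 Hf)), ns_norm_scal, Rabs_pos_eq in H
      by (left; apply Rinv_0_lt_compat, Hp).
    apply (Rmult_le_compat_l (ns_norm x)) in H; [|lra].
    rewrite <- Rmult_assoc, Rinv_r, Rmult_1_l in H by lra. lra.
Qed.

Lemma bounded_linear_add {X Y : NormedSpace} (f g : X -> Y) :
  bounded_linear f -> bounded_linear g -> bounded_linear (op_add f g).
Proof.
  intros [[Fa Fs] [M HM]] [[Ga Gs] [N HN]]. unfold op_add. split; [split|].
  - intros x y. rewrite Fa, Ga.
    rewrite <- !ns_add_assoc. f_equal. rewrite !ns_add_assoc. f_equal. apply ns_add_comm.
  - intros a x. rewrite Fs, Gs, ns_scal_distr_l. reflexivity.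
  - exists (M + N). intros x. eapply Rle_trans; [apply ns_norm_triangle|].
    specialize (HM x). specialize (HN x). lra.
Qed.

Lemma bounded_linear_scal {X Y : NormedSpace} (a : R) (f : X -> Y) :
  bounded_linear f -> bounded_linear (op_scal a f).
Proof.
  intros [[Fa Fs] [M HM]]. unfold op_scal. split; [split|].
  - intros x y. rewrite Fa, ns_scal_distr_l. reflexivity.
  - intros b x. rewrite Fs, !ns_scal_assoc, Rmult_comm. reflexivity.
  - exists (Rabs a * M). intros x. rewrite ns_norm_scal, Rmult_assoc.
    apply Rmult_le_compat_l; [apply Rabs_pos|apply HM].
Qed.

Lemma opnorm_scal {X Y : NormedSpace} (a : R) (f : X -> Y) :
  bounded_linear f -> 0 <= a -> opnorm (op_scal a f) = a * opnorm f.
Proof.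
  intros Hf Ha. pose proof (bounded_linear_scal a f Hf) as Haf.
  assert (E : forall x, ns_norm (op_scal a f x) = a * ns_norm (f x)).
  { intros x. unfold op_scal. rewrite ns_norm_scal, Rabs_pos_eq by exact Ha. reflexivity. }
  apply Rle_antisym.
  - apply opnorm_le; [exact Haf|]. intros x Hx. rewrite E.
    apply Rmult_le_compat_l; [exact Ha|]. apply opnorm_ge; auto.
  - destruct Ha as [Ha|<-].
    + apply (Rmult_le_reg_l (/ a)); [apply Rinv_0_lt_compat, Ha|].
      rewrite <- Rmult_assoc, Rinv_l, Rmult_1_l by lra.
      apply opnorm_le; [exact Hf|]. intros x Hx.
      apply (Rmult_le_reg_l a); [exact Ha|].
      rewrite <- Rmult_assoc, Rinv_r, Rmult_1_l by lra.
      rewrite <- E. apply opnorm_ge; auto.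
    + rewrite Rmult_0_l. apply opnorm_nonneg, Haf.
Qed.

(** These operators are the directions in which the derivative at [T] is tested against functionals
    of [X]. *)
Lemma rank_one_bounded_linear {X Y : NormedSpace} (f : X -> R) (y : Y) :
  dual_elt f -> bounded_linear (fun x => ns_scal (f x) y).
Proof.
  intros [Fa [Fs [M HM]]]. split; [split|].
  - intros u v. rewrite Fa, ns_scal_distr_r. reflexivity.
  - intros a u. rewrite Fs, ns_scal_assoc. reflexivity.
  - exists (M * ns_norm y). intros x. rewrite ns_norm_scal.
    specialize (HM x). pose proof (ns_norm_nonneg y). nra.
Qed.

(** The adjoint of [T] at [g]; it carries weak limits through [T]. *)
Lemma dual_comp {X Y : NormedSpace} (g : Y -> R) (T : X -> Y) :
  dual_elt g -> bounded_linear T -> dual_elt (fun x => g (T x)).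
Proof.
  intros [Ga [Gs [M HM]]] HT. destruct (HT) as [[Ta Ts] _]. split; [|split].
  - intros x y. rewrite Ta, Ga. reflexivity.
  - intros a x. rewrite Ts, Gs. reflexivity.
  - exists (Rabs M * opnorm T). intros x. pose proof (opnorm_mult T x HT).
    specialize (HM (T x)). pose proof (Rle_abs M). pose proof (Rabs_pos M).
    pose proof (ns_norm_nonneg (T x)). nra.
Qed.

(** * Derivatives of norms *)

(** The condition of [gateaux_diff_at] in a single direction; [c] stands for the value at [0], so
    that a norm known to be [1] can be rewritten there. *)
Definition has_slope (N : R -> R) (c D : R) : Prop :=
  forall eps, 0 < eps -> exists delta, 0 < delta /\
    forall h, h <> 0 -> Rabs h < delta -> Rabs ((N h - c) / h - D) < eps.

Lemma has_slope_scale (N : R -> R) (c D r : R) :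
  0 < r -> has_slope N c D -> has_slope (fun h => N (h * r)) c (r * D).
Proof.
  intros Hr HN eps Heps.
  destruct (HN (eps / r) (Rdiv_lt_0_compat _ _ Heps Hr)) as [d [Hd H]].
  exists (d / r). split; [apply Rdiv_lt_0_compat; assumption|].
  intros h Hh Hhd.
  assert (Hhr : Rabs (h * r) < d).
  { rewrite Rabs_mult, (Rabs_pos_eq r) by lra.
    apply (Rmult_lt_compat_r r) in Hhd; [|exact Hr].
    replace (d / r * r) with d in Hhd by (field; lra). exact Hhd. }
  specialize (H (h * r)
    (Rmult_integral_contrapositive_currified _ _ Hh (Rgt_not_eq _ _ Hr)) Hhr).
  replace ((N (h * r) - c) / h - r * D) with (r * ((N (h * r) - c) / (h * r) - D))
    by (field; split; lra).
  rewrite Rabs_mult, (Rabs_pos_eq r) by lra.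
  apply (Rmult_lt_compat_l r) in H; [|exact Hr].
  replace (r * (eps / r)) with eps in H by (field; lra). exact H.
Qed.

Lemma has_slope_increment (N : R -> R) (c D eps : R) :
  0 < eps -> has_slope N c D -> exists delta, 0 < delta /\
    forall h, h <> 0 -> Rabs h < delta -> Rabs (N h - c - h * D) < eps * Rabs h.
Proof.
  intros Heps HN. destruct (HN eps Heps) as [d [Hd H]].
  exists d. split; [exact Hd|]. intros h Hh Hhd. specialize (H h Hh Hhd).
  replace (N h - c - h * D) with (((N h - c) / h - D) * h) by (field; exact Hh).
  rewrite Rabs_mult. apply Rmult_lt_compat_r; [apply Rabs_pos_lt, Hh|exact H].
Qed.

(** Difference quotients are at least [g] for [h > 0] and at most [g] for [h < 0], so their common
    limit is [g]. Derivatives are identified below by exhibiting such lines. *)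
Lemma slope_of_supporting_line (N : R -> R) (c D g : R) :
  has_slope N c D -> (forall h, c + h * g <= N h) -> D = g.
Proof.
  intros HN Hg. destruct (Req_dec D g) as [|Hn]; [assumption|exfalso].
  assert (Hp : 0 < Rabs (D - g)) by (apply Rabs_pos_lt; lra).
  destruct (has_slope_increment N c D _ Hp HN) as [d [Hd H]].
  destruct (Rlt_dec D g) as [Hlt|Hge].
  - specialize (H (d / 2) ltac:(lra)). rewrite (Rabs_pos_eq (d / 2)) in H by lra.
    specialize (H ltac:(lra)). apply Rabs_def2 in H.
    rewrite (Rabs_left (D - g)) in H by lra. specialize (Hg (d / 2)). nra.
  - specialize (H (- (d / 2)) ltac:(lra)).
    rewrite (Rabs_left (- (d / 2))) in H by lra.
    specialize (H ltac:(lra)). apply Rabs_def2 in H.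
    rewrite (Rabs_pos_eq (D - g)) in H by lra. specialize (Hg (- (d / 2))). nra.
Qed.

Lemma ns_norm_convex {V : NormedSpace} (x y : V) (t : R) :
  0 <= t <= 1 ->
  ns_norm (ns_add x (ns_scal t y)) <= (1 - t) * ns_norm x + t * ns_norm (ns_add x y).
Proof.
  intros Ht.
  replace (ns_add x (ns_scal t y)) with
    (ns_add (ns_scal (1 - t) x) (ns_scal t (ns_add x y))) by vec x y y.
  eapply Rle_trans; [apply ns_norm_triangle|].
  rewrite !ns_norm_scal, !Rabs_pos_eq by lra. lra.
Qed.

(** The tangent of a convex function lies below its graph: a deficit [d] at [h] would give a deficit
    of at least [t * d] at [t * h], too large for small [t]. *)
Lemma norm_derivative_supports {V : NormedSpace} (z y : V) (D : R) :
  ns_norm z = 1 -> has_slope (fun h => ns_norm (ns_add z (ns_scal h y))) 1 D ->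
  forall h, 1 + h * D <= ns_norm (ns_add z (ns_scal h y)).
Proof.
  intros Hz HD h. destruct (Req_dec h 0) as [->|Hh].
  { rewrite ns_scal_zero_l, ns_add_comm, ns_add_zero, Hz. lra. }
  apply Rnot_lt_le. intros Hlt.
  set (N := ns_norm (ns_add z (ns_scal h y))) in *.
  assert (Hah : 0 < Rabs h) by (apply Rabs_pos_lt, Hh).
  set (d := 1 + h * D - N). assert (Hd : 0 < d) by (unfold d; lra).
  destruct (has_slope_increment _ 1 D (d / Rabs h) (Rdiv_lt_0_compat _ _ Hd Hah) HD)
    as [e [He H]].
  (* Small enough for [t * h] to lie within [e] of [0], and at most [1] for convexity. *)
  set (t := Rmin 1 (e / (2 * Rabs h))).
  assert (Ht1 : t <= 1) by apply Rmin_l.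
  assert (Hte : t * Rabs h <= e / 2).
  { replace (e / 2) with (e / (2 * Rabs h) * Rabs h) by (field; lra).
    apply Rmult_le_compat_r; [lra|apply Rmin_r]. }
  assert (Ht0 : 0 < t) by (apply Rmin_glb_lt; [lra|apply Rdiv_lt_0_compat; lra]).
  assert (Hath : Rabs (t * h) = t * Rabs h) by (rewrite Rabs_mult, (Rabs_pos_eq t); lra).
  specialize (H (t * h) (Rmult_integral_contrapositive_currified _ _ (Rgt_not_eq _ _ Ht0) Hh)
                ltac:(lra)).
  rewrite Hath in H. replace (d / Rabs h * (t * Rabs h)) with (t * d) in H by (field; lra).
  apply Rabs_def2 in H.
  pose proof (ns_norm_convex z (ns_scal h y) t ltac:(lra)) as Hc.
  rewrite ns_scal_assoc, Hz in Hc. fold N in Hc. unfold d in H. nra.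
Qed.

(** [G] is the derivative of the norm at [z]. The last clause states the uniformity for all small
    vectors, no longer for unit directions. *)
Lemma frechet_support {Y : NormedSpace} (z : Y) :
  frechet_space Y -> ns_norm z = 1 ->
  exists G : Y -> R,
    (forall a y, G (ns_scal a y) = a * G y) /\
    (forall y, 1 + G y <= ns_norm (ns_add z y)) /\
    (forall y, Rabs (G y) <= ns_norm y) /\ G z = 1 /\
    forall eps, 0 < eps -> exists delta, 0 < delta /\ forall y, ns_norm y <= delta ->
      ns_norm (ns_add z y) <= 1 + G y + eps * ns_norm y.
Proof.
  intros HY Hz. destruct (HY z Hz) as [L HL]. rewrite Hz in HL.
  (* [L] is controlled on the unit sphere only, so it is extended homogeneously; the factor
     [ns_norm y] gives the value [0] at [ns_zero]. *)
  set (G := fun y => ns_norm y * L (ns_scal (/ ns_norm y) y)).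
  assert (Hunit : forall y : Y, y <> ns_zero ->
    ns_scal (ns_norm y) (ns_scal (/ ns_norm y) y) = y).
  { intros y Hy. destruct (ns_normalize y Hy) as [Hp _].
    rewrite ns_scal_assoc, Rinv_r, ns_scal_one by lra. reflexivity. }
  assert (Hslope : forall y : Y, has_slope (fun h => ns_norm (ns_add z (ns_scal h y))) 1 (G y)).
  { intros y. destruct (classic (y = ns_zero)) as [->|Hy].
    - intros eps Heps. exists 1. split; [lra|]. intros h Hh _. unfold G.
      replace (ns_add z (ns_scal h ns_zero)) with z by vec z z z.
      rewrite Hz, ns_norm_zero.
      replace ((1 - 1) / h - 0 * L (ns_scal (/ 0) ns_zero)) with 0 by (field; exact Hh).
      rewrite Rabs_R0. exact Heps.
    - destruct (ns_normalize y Hy) as [Hp H1].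
      pose (e := ns_scal (/ ns_norm y) y).
      pose proof (has_slope_scale (fun h => ns_norm (ns_add z (ns_scal h e))) 1 (L e)
                    (ns_norm y) Hp) as H.
      assert (E : (fun h => ns_norm (ns_add z (ns_scal (h * ns_norm y) e))) =
                  (fun h => ns_norm (ns_add z (ns_scal h y)))).
      { apply functional_extensionality. intros h. rewrite <- ns_scal_assoc.
        unfold e. rewrite Hunit by exact Hy. reflexivity. }
      cbv beta in H. rewrite E in H. apply H. intros eps Heps.
      destruct (HL eps Heps) as [d [Hd Hde]]. exists d. split; [exact Hd|].
      intros h Hh Hhd. apply Hde; auto. }
  assert (Hline : forall (y : Y) (h : R), 1 + h * G y <= ns_norm (ns_add z (ns_scal h y))).
  { intros y. apply norm_derivative_supports; auto. }
  (* The line of slope [a * G y] supports the norm in the direction [ns_scal a y]. *)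
  assert (Hhom : forall (a : R) (y : Y), G (ns_scal a y) = a * G y).
  { intros a y. apply (slope_of_supporting_line _ _ _ _ (Hslope (ns_scal a y))).
    intros h. rewrite ns_scal_assoc. rewrite <- Rmult_assoc. apply Hline. }
  assert (Hline1 : forall y : Y, 1 + G y <= ns_norm (ns_add z y)).
  { intros y. specialize (Hline y 1). rewrite ns_scal_one in Hline. lra. }
  assert (Hle : forall y : Y, G y <= ns_norm y).
  { intros y. specialize (Hline1 y). pose proof (ns_norm_triangle Y z y). lra. }
  exists G. split; [exact Hhom|split; [exact Hline1|split; [|split]]].
  - intros y. apply Rabs_le. split; [|apply Hle].
    pose proof (Hle (ns_scal (-1) y)) as H.
    rewrite Hhom, <- ns_opp_scal, ns_norm_opp in H. lra.
  - apply Rle_antisym; [rewrite <- Hz; apply Hle|].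
    pose proof (Hline1 (ns_scal (-1) z)) as H.
    rewrite Hhom, <- ns_opp_scal, ns_add_opp, ns_norm_zero in H. lra.
  - intros eps Heps. destruct (HL eps Heps) as [d [Hd H]].
    exists (d / 2). split; [lra|]. intros y Hyd.
    destruct (classic (y = ns_zero)) as [->|Hy].
    + replace (ns_add z ns_zero) with z by vec z z z. unfold G.
      rewrite Hz, ns_norm_zero. lra.
    + destruct (ns_normalize y Hy) as [Hp H1].
      (* The unit direction of [y] is taken with increment [h = ns_norm y]; the radius [d / 2] makes
         the bound by [d] strict. *)
      pose proof (H _ I H1 (ns_norm y) ltac:(lra)) as H2.
      rewrite (Rabs_pos_eq (ns_norm y)) in H2 by lra. specialize (H2 ltac:(lra)).
      rewrite Hunit in H2 by exact Hy. apply Rabs_def2 in H2 as [H2 _].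
      apply (Rmult_lt_compat_l (ns_norm y)) in H2; [|exact Hp].
      unfold G. set (l := L _) in *.
      replace (ns_norm y * ((ns_norm (ns_add z y) - 1) / ns_norm y - l))
        with (ns_norm (ns_add z y) - 1 - ns_norm y * l) in H2 by (field; lra).
      lra.
Qed.

(** * Vectors at which the norm of a compact operator is attained *)

Lemma attaining_unit {X Y : NormedSpace} (T : X -> Y) (x : X) :
  bounded_linear T -> opnorm T = 1 -> ns_norm x <= 1 -> ns_norm (T x) = 1 ->
  ns_norm x = 1.
Proof.
  intros HT H1 Hx HTx. pose proof (opnorm_mult T x HT) as H. rewrite H1, HTx in H. lra.
Qed.

(* Both [x1] and [x2] compute the derivative of the operator norm at [T]; testing
   it on the operators [f (x) T x1] shows that no functional separates [x1] from a
   multiple of [x2]. *)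
Lemma gateaux_attaining_unique {X Y : NormedSpace} (T : X -> Y) (x1 x2 : X) :
  frechet_space Y -> bounded_linear T -> opnorm T = 1 ->
  gateaux_diff_at (@bounded_linear X Y) op_add op_scal opnorm T ->
  ns_norm x1 <= 1 -> ns_norm (T x1) = 1 -> ns_norm x2 <= 1 -> ns_norm (T x2) = 1 ->
  exists c, (c = 1 \/ c = -1) /\ x1 = ns_scal c x2.
Proof.
  intros HY HT HT1 Hgat Hx1 HTx1 Hx2 HTx2.
  destruct (frechet_support (T x1) HY HTx1) as [G1 [Hhom1 [Hline1 [_ [HG1 _]]]]].
  destruct (frechet_support (T x2) HY HTx2) as [G2 [Hhom2 [Hline2 _]]].
  assert (Hder : forall S, bounded_linear S -> G1 (S x1) = G2 (S x2)).
  { intros S HS. destruct (Hgat S HS) as [D HD]. rewrite HT1 in HD.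
    transitivity D; [symmetry|]; apply (slope_of_supporting_line _ _ _ _ HD); intros h;
      pose proof (bounded_linear_add T _ HT (bounded_linear_scal h S HS)) as HB.
    - eapply Rle_trans; [|apply (opnorm_ge _ x1 HB Hx1)].
      rewrite <- Hhom1. apply Hline1.
    - eapply Rle_trans; [|apply (opnorm_ge _ x2 HB Hx2)].
      rewrite <- Hhom2. apply Hline2. }
  (* For the operator sending [x] to [f x] times [T x1], [Hder] reads [f x1 = f x2 * k], because
     [G1 (T x1) = 1]. *)
  set (k := G2 (T x1)).
  assert (Hx : x1 = ns_scal k x2).
  { apply ns_sub_eq0.
    destruct (norming_functional (ns_sub x1 (ns_scal k x2))) as [f [Hf [_ Hfx]]].
    rewrite <- Hfx, dual_sub by exact Hf. rewrite (proj1 (proj2 Hf)).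
    pose proof (Hder _ (rank_one_bounded_linear f (T x1) Hf)) as H.
    cbv beta in H. rewrite Hhom1, Hhom2, HG1 in H. fold k in H. lra. }
  exists k. split; [|exact Hx].
  assert (Hk : Rabs k = 1).
  { pose proof (attaining_unit T x1 HT HT1 Hx1 HTx1) as H.
    rewrite Hx, ns_norm_scal, (attaining_unit T x2 HT HT1 Hx2 HTx2) in H. lra. }
  unfold Rabs in Hk. destruct (Rcase_abs k); [right|left]; lra.
Qed.

(** For every dual [g], the values [g (T (u n))] tend to [g (T x)] along [U] and to [g y] in the
    ordinary sense, so no functional separates [T x] from [y]. *)
Lemma weak_ulim_compact {X Y : NormedSpace} (U : (nat -> Prop) -> Prop) (T : X -> Y)
  (u : nat -> X) (y : Y) :
  free_ultrafilter U -> reflexive X -> bounded_linear T ->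
  (forall n, ns_norm (u n) <= 1) -> ns_cv (fun n => T (u n)) y ->
  exists x, ns_norm x <= 1 /\ T x = y /\
    forall f, dual_elt f -> is_ulim U (fun n => f (u n)) (f x).
Proof.
  intros HU Hrefl HT Hu Hy.
  destruct (weak_ulim U u HU Hrefl Hu) as [x [Hx Hlim]].
  exists x. split; [exact Hx|split; [|exact Hlim]].
  apply ns_sub_eq0.
  destruct (norming_functional (ns_sub (T x) y)) as [g [Hg [Hgb Hgx]]].
  rewrite <- Hgx, dual_sub by exact Hg.
  assert (g (T x) = g y); [|lra].
  apply (ulim_unique U HU (fun n => g (T (u n)))).
  - exact (Hlim _ (dual_comp g T Hg HT)).
  - apply (Un_cv_ulim U HU). intros eps Heps. destruct (Hy eps Heps) as [N HN].
    exists N. intros n Hn. specialize (HN n Hn). unfold Rdist in *.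
    rewrite Rminus_0_r, Rabs_pos_eq in HN by apply ns_norm_nonneg.
    rewrite <- dual_sub by exact Hg. eapply Rle_lt_trans; [apply Hgb|exact HN].
Qed.

Lemma ns_cv_reindex {V : NormedSpace} (u : nat -> V) (l : V) (phi : nat -> nat) :
  (forall n, (n <= phi n)%nat) -> ns_cv u l -> ns_cv (fun n => u (phi n)) l.
Proof.
  intros Hphi Hu eps Heps. destruct (Hu eps Heps) as [N HN]. exists N.
  intros n Hn. apply HN. specialize (Hphi n). lia.
Qed.

(* Weak convergence is tested on subsequences: each ultrafilter limit attains the
   norm and has image [y], hence is the same vector. *)
Lemma attaining_sequence_cv {X Y : NormedSpace} (T : X -> Y) (u : nat -> X) (y : Y) :
  reflexive X -> kadets_klee X -> bounded_linear T -> opnorm T = 1 ->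
  (forall x1 x2, ns_norm x1 <= 1 -> ns_norm (T x1) = 1 -> ns_norm x2 <= 1 ->
     ns_norm (T x2) = 1 -> exists c, (c = 1 \/ c = -1) /\ x1 = ns_scal c x2) ->
  (forall n, ns_norm (u n) <= 1) -> ns_cv (fun n => T (u n)) y -> ns_norm y = 1 ->
  exists x, ns_norm x <= 1 /\ T x = y /\ ns_cv u x.
Proof.
  intros Hrefl HKK HT HT1 Huniq Hu Hy Hy1.
  destruct free_ultrafilter_exists as [U HU].
  destruct (weak_ulim_compact U T u y HU Hrefl HT Hu Hy) as [x [Hx [HTx _]]].
  exists x. split; [exact Hx|split; [exact HTx|]].
  assert (Hx1 : ns_norm x = 1) by (apply (attaining_unit T x); rewrite ?HTx; assumption).
  apply HKK.
  - intros f Hf. apply NNPP. intros Hncv.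
    assert (Hfar : exists eps, 0 < eps /\
      forall N, exists n, (N <= n)%nat /\ eps <= Rabs (f (u n) - f x)).
    { apply NNPP. intros Hno. apply Hncv. intros eps Heps. apply NNPP. intros HnN.
      apply Hno. exists eps. split; [exact Heps|]. intros N. apply NNPP. intros Hn.
      apply HnN. exists N. intros n HNn. apply Rnot_le_lt. intros Hle.
      apply Hn. exists n. split; [exact HNn|apply Rge_le, Rle_ge, Hle]. }
    destruct Hfar as [eps [Heps Hfar]].
    (* [m] is not claimed to be increasing; [N <= m N] is enough to keep the limit [y] of the
       images. *)
    assert (Hsub : exists m : nat -> nat,
      forall N, (N <= m N)%nat /\ eps <= Rabs (f (u (m N)) - f x)).
    { exists (fun N => proj1_sig (constructive_indefinite_description _ (Hfar N))).
      intros N. apply proj2_sig. }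
    destruct Hsub as [m Hm].
    destruct (weak_ulim_compact U T (fun n => u (m n)) y HU Hrefl HT) as
      [x' [Hx' [HTx' Hlim]]].
    + intros n. apply Hu.
    + apply (ns_cv_reindex (fun n => T (u n))); [apply Hm|exact Hy].
    + assert (E : x' = x).
      { destruct (Huniq x' x) as [c [Hc Hcx]]; rewrite ?HTx, ?HTx'; try assumption.
        (* The sign [-1] is excluded: both vectors have image [y], so [y] would equal its opposite
           and vanish. *)
        destruct Hc as [->| ->]; [rewrite Hcx; apply ns_scal_one|exfalso].
        assert (Eq : y = ns_scal (-1) y).
        { rewrite <- HTx at 2. rewrite <- (proj2 (proj1 HT)), <- Hcx. auto. }
        assert (E0 : y = ns_zero).
        { replace y with (ns_scal (/ 2) (ns_add y y)) by vec y y y.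
          rewrite Eq at 2. vec y y y. }
        rewrite E0, ns_norm_zero in Hy1. lra. }
      subst x'.
      pose proof (ulim_away U HU _ _ (f x) eps (Hlim f Hf) (fun n => proj2 (Hm n))) as H.
      rewrite Rminus_diag, Rabs_R0 in H. lra.
  (* The norms are squeezed: [ns_norm (T (u n)) <= ns_norm (u n) <= 1], and the left side tends to
     [1]. *)
  - rewrite Hx1. intros eps Heps. destruct (Hy eps Heps) as [N HN]. exists N.
    intros n Hn. specialize (HN n Hn). unfold Rdist in *.
    rewrite Rminus_0_r, Rabs_pos_eq in HN by apply ns_norm_nonneg.
    pose proof (opnorm_mult T (u n) HT) as H. rewrite HT1 in H.
    pose proof (ns_norm_le_add_sub y (T (u n))) as H2.
    rewrite ns_norm_sub_sym in H2. specialize (Hu n).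
    apply Rabs_def1; lra.
Qed.

(** Along the subsequence given by compactness, the norms of the images lie between
    [1 - / INR (S (phi n))] and [1], so their limit has norm [1]. *)
Lemma compact_maximizing {X Y : NormedSpace} (T : X -> Y) (u : nat -> X) :
  compact_op T -> opnorm T = 1 -> (forall n, ns_norm (u n) <= 1) ->
  (forall n, 1 - / INR (S n) < ns_norm (T (u n))) ->
  exists (phi : nat -> nat) (y : Y), (forall n, (n <= phi n)%nat) /\
    ns_cv (fun n => T (u (phi n))) y /\ ns_norm y = 1.
Proof.
  intros [HT Hcpt] HT1 Hu HTu.
  destruct (Hcpt u (ex_intro _ 1 Hu)) as [phi [y [Hinc Hy]]].
  assert (Hphi : forall n, (n <= phi n)%nat).
  { induction n as [|n IH]; [lia|]. specialize (Hinc n). lia. }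
  exists phi, y. split; [exact Hphi|split; [exact Hy|]].
  assert (Hclose : forall eps, 0 < eps -> Rabs (ns_norm y - 1) < eps).
  { intros eps Heps. destruct (Hy (eps / 2) ltac:(lra)) as [N HN].
    destruct (archimed_cor1 (eps / 2) ltac:(lra)) as [K [HK HK0]].
    set (n := Nat.max N K). specialize (HN n ltac:(lia)). unfold Rdist in HN.
    rewrite Rminus_0_r, Rabs_pos_eq in HN by apply ns_norm_nonneg.
    specialize (HTu (phi n)).
    assert (Hinv : / INR (S (phi n)) <= / INR K).
    { apply Rinv_le_contravar; [apply lt_0_INR; lia|]. apply le_INR.
      specialize (Hphi n). lia. }
    pose proof (opnorm_ge T (u (phi n)) HT (Hu _)) as Hle. rewrite HT1 in Hle.
    pose proof (ns_norm_le_add_sub y (T (u (phi n)))) as H1.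
    rewrite ns_norm_sub_sym in H1.
    pose proof (ns_norm_le_add_sub (T (u (phi n))) y) as H2.
    apply Rabs_def1; lra. }
  apply NNPP. intros Hn.
  specialize (Hclose (Rabs (ns_norm y - 1))). apply (Rlt_irrefl (Rabs (ns_norm y - 1))).
  apply Hclose, Rabs_pos_lt. lra.
Qed.

(** The weak ultrafilter limit of a maximizing sequence is sent by [T] to the norm limit of the
    images. *)
Lemma compact_attains {X Y : NormedSpace} (T : X -> Y) :
  reflexive X -> compact_op T -> opnorm T = 1 ->
  exists x, ns_norm x <= 1 /\ ns_norm (T x) = 1.
Proof.
  intros Hrefl HT HT1.
  assert (Hex : forall n, exists x, ns_norm x <= 1 /\ 1 - / INR (S n) < ns_norm (T x)).
  { intros n. apply (opnorm_approx T _ (proj1 HT)). rewrite HT1.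
    assert (0 < / INR (S n)) by (apply Rinv_0_lt_compat, lt_0_INR; lia). lra. }
  pose (u := fun n => proj1_sig (constructive_indefinite_description _ (Hex n))).
  assert (Hu : forall n, ns_norm (u n) <= 1 /\ 1 - / INR (S n) < ns_norm (T (u n))).
  { intros n. apply proj2_sig. }
  destruct (compact_maximizing T u HT HT1 (fun n => proj1 (Hu n)) (fun n => proj2 (Hu n)))
    as [phi [y [_ [Hy Hy1]]]].
  destruct free_ultrafilter_exists as [U HU].
  destruct (weak_ulim_compact U T (fun n => u (phi n)) y HU Hrefl (proj1 HT)
              (fun n => proj1 (Hu (phi n))) Hy) as [x [Hx [HTx _]]].
  exists x. rewrite HTx. auto.
Qed.

(** Otherwise the failures for [rho = / INR (S n)] form a maximizing sequence staying [eta] away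
    from [x0] up to sign, while a subsequence converges to a maximizer, which is [x0] up to sign. *)
Lemma near_maximizers {X Y : NormedSpace} (T : X -> Y) (x0 : X) (eta : R) :
  reflexive X -> kadets_klee X -> compact_op T -> opnorm T = 1 ->
  (forall x1 x2, ns_norm x1 <= 1 -> ns_norm (T x1) = 1 -> ns_norm x2 <= 1 ->
     ns_norm (T x2) = 1 -> exists c, (c = 1 \/ c = -1) /\ x1 = ns_scal c x2) ->
  ns_norm x0 <= 1 -> ns_norm (T x0) = 1 -> 0 < eta ->
  exists rho, 0 < rho /\ forall x, ns_norm x <= 1 -> 1 - rho < ns_norm (T x) ->
    exists c, (c = 1 \/ c = -1) /\ ns_norm (ns_sub (ns_scal c x) x0) < eta.
Proof.
  intros Hrefl HKK HT HT1 Huniq Hx0 HTx0 Heta. apply NNPP. intros Hno.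
  assert (Hex : forall n, exists x, ns_norm x <= 1 /\ 1 - / INR (S n) < ns_norm (T x) /\
    forall c, c = 1 \/ c = -1 -> eta <= ns_norm (ns_sub (ns_scal c x) x0)).
  { intros n. apply NNPP. intros Hn. apply Hno. exists (/ INR (S n)).
    split; [apply Rinv_0_lt_compat, lt_0_INR; lia|]. intros x Hx HTx.
    apply NNPP. intros Hc. apply Hn. exists x. split; [exact Hx|split; [exact HTx|]].
    intros c Hc1. apply Rnot_lt_le. intros Hlt. apply Hc. eauto. }
  pose (u := fun n => proj1_sig (constructive_indefinite_description _ (Hex n))).
  assert (Hu : forall n, ns_norm (u n) <= 1 /\ 1 - / INR (S n) < ns_norm (T (u n)) /\
    forall c, c = 1 \/ c = -1 -> eta <= ns_norm (ns_sub (ns_scal c (u n)) x0)).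
  { intros n. apply proj2_sig. }
  destruct (compact_maximizing T u HT HT1 (fun n => proj1 (Hu n))
              (fun n => proj1 (proj2 (Hu n)))) as [phi [y [_ [Hy Hy1]]]].
  destruct (attaining_sequence_cv T (fun n => u (phi n)) y Hrefl HKK (proj1 HT) HT1 Huniq
              (fun n => proj1 (Hu (phi n))) Hy Hy1) as [x [Hx [HTx Hcv]]].
  destruct (Huniq x x0) as [c [Hc Hcx]]; rewrite ?HTx; try assumption.
  destruct (Hcv eta Heta) as [N HN]. specialize (HN N (le_n N)). unfold Rdist in HN.
  rewrite Rminus_0_r, Rabs_pos_eq in HN by apply ns_norm_nonneg.
  pose proof (proj2 (proj2 (Hu (phi N))) c Hc) as Hfar.
  (* Valid because [x = c x0] and [c * c = 1]. *)
  replace (ns_sub (ns_scal c (u (phi N))) x0) with (ns_scal c (ns_sub (u (phi N)) x)) in Hfar.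
  - rewrite ns_norm_scal in Hfar.
    replace (Rabs c) with 1 in Hfar; [lra|].
    destruct Hc as [->| ->]; [rewrite Rabs_R1|rewrite Rabs_left]; lra.
  - rewrite Hcx. set (v := u (phi N)).
    destruct Hc as [->| ->]; vec v x0 x0.
Qed.

(** * Equivalence of the two kinds of differentiability at [T] *)

Lemma gateaux_frechet {X Y : NormedSpace} (T : X -> Y) :
  reflexive X -> kadets_klee X -> frechet_space Y -> compact_op T -> opnorm T = 1 ->
  gateaux_diff_at (@bounded_linear X Y) op_add op_scal opnorm T ->
  frechet_diff_at (@bounded_linear X Y) op_add op_scal opnorm T.
Proof.
  intros Hrefl HKK HY HT HT1 Hgat. destruct (HT) as [HTb _].
  destruct (compact_attains T Hrefl HT HT1) as [x0 [Hx0 HTx0]].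
  destruct (frechet_support (T x0) HY HTx0) as [G [Hhom [Hline [Hbound [_ Hunif]]]]].
  exists (fun S => G (S x0)). intros eps Heps. rewrite HT1.
  destruct (Hunif (eps / 4) ltac:(lra)) as [tau [Htau Hup]].
  (* Moving [z] to [x0] changes [T z + k S z], where [|k| = tau], by at most [1 + tau] times their
     distance; this radius keeps the change below [tau * (eps / 4)]. *)
  destruct (near_maximizers T x0 (tau * (eps / 4) / (1 + tau)) Hrefl HKK HT HT1)
    as [rho [Hrho Hnear]]; try assumption.
  { intros x1 x2 H1 H2 H3 H4. apply (gateaux_attaining_unique T x1 x2); assumption. }
  { apply Rdiv_lt_0_compat; [apply Rmult_lt_0_compat|]; lra. }
  (* The first bound makes [|h| / tau <= 1]. The second keeps near-maximizers of [T + h S] within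
     [rho] of maximizing [T]: the loss is [|h|] from the norm of [T + h S], [|h| * eps / 4] from the
     approximation and [|h|] from dropping [h S]. *)
  exists (Rmin tau (rho / (2 + eps / 4))).
  split; [apply Rmin_glb_lt; [lra|apply Rdiv_lt_0_compat; lra]|].
  intros S HS HS1 h Hh Hhd.
  assert (Hh1 : Rabs h < tau) by (eapply Rlt_le_trans; [exact Hhd|apply Rmin_l]).
  assert (Hh2 : Rabs h * (2 + eps / 4) < rho).
  { assert (H : Rabs h < rho / (2 + eps / 4))
      by (eapply Rlt_le_trans; [exact Hhd|apply Rmin_r]).
    apply (Rmult_lt_compat_r (2 + eps / 4)) in H; [|lra].
    replace (rho / (2 + eps / 4) * (2 + eps / 4)) with rho in H by (field; lra).
    exact H. }
  assert (Hah : 0 < Rabs h) by (apply Rabs_pos_lt, Hh).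
  assert (HSn : forall x, ns_norm (S x) <= ns_norm x).
  { intros x. pose proof (opnorm_mult S x HS) as H. rewrite HS1 in H. lra. }
  set (g := G (S x0)).
  assert (Hg : Rabs g <= 1).
  { pose proof (Hbound (S x0)). specialize (HSn x0). unfold g. lra. }
  pose proof (bounded_linear_add T _ HTb (bounded_linear_scal h S HS)) as HB.
  set (N := opnorm (op_add T (op_scal h S))).
  assert (Hlow : 1 + h * g <= N).
  { eapply Rle_trans; [|apply (opnorm_ge _ x0 HB Hx0)].
    unfold g. rewrite <- Hhom. apply Hline. }
  assert (Hhg : - Rabs h <= h * g).
  { assert (H : Rabs (h * g) <= Rabs h) by (rewrite Rabs_mult; nra).
    pose proof (Rle_abs (- (h * g))) as H'. rewrite Rabs_Ropp in H'. lra. }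
  assert (Hhigh : N - 1 - h * g < eps * Rabs h).
  { destruct (opnorm_approx _ (N - Rabs h * (eps / 4)) HB) as [x [Hx HNx]].
    { fold N. nra. }
    unfold op_add, op_scal in HNx.
    assert (HTx : 1 - rho < ns_norm (T x)).
    { pose proof (ns_norm_triangle Y (T x) (ns_scal h (S x))) as H.
      rewrite ns_norm_scal in H. specialize (HSn x). nra. }
    destruct (Hnear x Hx HTx) as [c [Hc Hcx]]. set (z := ns_scal c x) in *.
    assert (Hac : Rabs c = 1).
    { destruct Hc as [->| ->]; [apply Rabs_R1|rewrite Rabs_left; lra]. }
    assert (Hz : ns_norm z <= 1) by (unfold z; rewrite ns_norm_scal, Hac; lra).
    (* The sign [c] leaves the norm of the image under [T + h S] unchanged, so [x] may be replaced
       by [z], which is close to [x0]. *)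
    assert (Ez : ns_norm (ns_add (T z) (ns_scal h (S z))) =
                 ns_norm (ns_add (T x) (ns_scal h (S x)))).
    { unfold z. rewrite (proj2 (proj1 HTb)), (proj2 (proj1 HS)).
      replace (ns_add (ns_scal c (T x)) (ns_scal h (ns_scal c (S x))))
        with (ns_scal c (ns_add (T x) (ns_scal h (S x))))
        by (generalize (T x) (S x); intros p q; vec p q q).
      rewrite ns_norm_scal, Hac. lra. }
    (* [k] is [tau] with the sign of [h]: the slope of a convex function at [0]
       in direction [h] is at most its slope between [0] and [k]. *)
    set (a := Rabs h / tau). set (k := h * tau / Rabs h).
    assert (Ha : 0 <= a <= 1).
    { unfold a. split; [left; apply Rdiv_lt_0_compat; lra|].
      apply (Rmult_le_reg_r tau); [lra|]. unfold Rdiv.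
      rewrite Rmult_assoc, Rinv_l; lra. }
    assert (Hak : a * k = h) by (unfold a, k; field; lra).
    assert (Habsk : Rabs k = tau).
    { unfold k, Rdiv. rewrite !Rabs_mult, Rabs_inv, Rabs_Rabsolu, (Rabs_pos_eq tau) by lra.
      field; lra. }
    assert (Hat : a * tau = Rabs h) by (unfold a; field; lra).
    pose proof (ns_norm_convex (T z) (ns_scal k (S z)) a Ha) as Hconv.
    rewrite ns_scal_assoc, Hak, Ez in Hconv.
    assert (HTz : ns_norm (T z) <= 1) by (rewrite <- HT1; apply opnorm_ge; assumption).
    pose proof (ns_norm_le_add_sub (ns_add (T z) (ns_scal k (S z)))
                  (ns_add (T x0) (ns_scal k (S x0)))) as Hdiff.
    replace (ns_sub (ns_add (T z) (ns_scal k (S z))) (ns_add (T x0) (ns_scal k (S x0))))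
      with (ns_add (T (ns_sub z x0)) (ns_scal k (S (ns_sub z x0)))) in Hdiff.
    2:{ rewrite !linear_sub by first [apply HTb|apply HS].
        unfold ns_sub. rewrite !ns_opp_scal.
        rewrite !ns_scal_distr_l, !ns_scal_assoc.
        rewrite (Rmult_comm k (-1)).
        generalize (T z) (T x0) (ns_scal k (S z)); intros p q r.
        generalize (S x0); intros s.
        rewrite <- !ns_add_assoc. f_equal. rewrite !ns_add_assoc. f_equal.
        apply ns_add_comm. }
    pose proof (ns_norm_triangle Y (T (ns_sub z x0)) (ns_scal k (S (ns_sub z x0)))) as Htri.
    rewrite ns_norm_scal, Habsk in Htri.
    pose proof (opnorm_mult T (ns_sub z x0) HTb) as HTd. rewrite HT1 in HTd.
    pose proof (HSn (ns_sub z x0)) as HSd.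
    pose proof (Hup (ns_scal k (S x0))) as Hk. rewrite ns_norm_scal, Habsk, Hhom in Hk.
    fold g in Hk. pose proof (HSn x0) as HSx0.
    specialize (Hk ltac:(nra)).
    set (d := ns_norm (ns_sub z x0)) in *.
    assert (Hd : d * (1 + tau) < tau * (eps / 4)).
    { apply (Rmult_lt_compat_r (1 + tau)) in Hcx; [|lra].
      replace (tau * (eps / 4) / (1 + tau) * (1 + tau)) with (tau * (eps / 4)) in Hcx
        by (field; lra). exact Hcx. }
    (* One [eps / 4] pays for moving [z] to [x0], the other for the first-order bound at [T x0]. *)
    assert (Hfin : ns_norm (ns_add (T z) (ns_scal k (S z))) <=
                   1 + k * g + tau * (eps / 2)).
    { apply (Rmult_le_compat_l tau) in HSd; [|lra].
      assert (HSx1 : ns_norm (S x0) <= 1) by lra.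
      apply (Rmult_le_compat_l (eps / 4 * tau)) in HSx1; [|nra].
      lra. }
    (* Convexity brings the estimate from [k] back to [h = a * k], and the error shrinks from
       [tau * (eps / 2)] to [Rabs h * (eps / 2)]. *)
    assert (Hend : ns_norm (ns_add (T x) (ns_scal h (S x))) <=
                   1 + h * g + Rabs h * (eps / 2)).
    { apply (Rmult_le_compat_l a) in Hfin; [|lra].
      apply (Rmult_le_compat_l (1 - a)) in HTz; [|lra].
      replace (a * (1 + k * g + tau * (eps / 2)))
        with (a + a * k * g + a * tau * (eps / 2)) in Hfin by ring.
      rewrite Hak, Hat in Hfin. lra. }
    nra. }
  replace ((N - 1) / h - g) with ((N - 1 - h * g) / h) by (field; exact Hh).
  unfold Rdiv. rewrite Rabs_mult, Rabs_inv, Rabs_pos_eq by lra.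
  apply (Rmult_lt_reg_r (Rabs h)); [exact Hah|].
  rewrite Rmult_assoc, Rinv_l by lra. lra.
Qed.

(** The uniform limit concerns operators of norm [1]; any other nonzero direction is reached by
    rescaling the increment. *)
Lemma frechet_gateaux {X Y : NormedSpace} (T : X -> Y) :
  frechet_diff_at (@bounded_linear X Y) op_add op_scal opnorm T ->
  gateaux_diff_at (@bounded_linear X Y) op_add op_scal opnorm T.
Proof.
  intros [L HL] S HS.
  destruct (opnorm_nonneg S HS) as [Hp|H0].
  - pose (e := op_scal (/ opnorm S) S).
    assert (He : bounded_linear e) by (apply bounded_linear_scal, HS).
    assert (He1 : opnorm e = 1).
    { unfold e. rewrite opnorm_scal; [apply Rinv_l; lra|exact HS|].
      left. apply Rinv_0_lt_compat, Hp. }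
    exists (opnorm S * L e).
    pose proof (has_slope_scale (fun h => opnorm (op_add T (op_scal h e))) (opnorm T) (L e)
                  (opnorm S) Hp) as H.
    assert (E : (fun h => opnorm (op_add T (op_scal (h * opnorm S) e))) =
                (fun h => opnorm (op_add T (op_scal h S)))).
    { apply functional_extensionality. intros h. f_equal. f_equal.
      apply functional_extensionality. intros x. unfold e, op_scal.
      rewrite ns_scal_assoc. f_equal. field. lra. }
    cbv beta in H. rewrite E in H. apply H. intros eps Heps.
    destruct (HL eps Heps) as [d [Hd Hde]]. exists d. split; [exact Hd|].
    intros h Hh Hhd. apply Hde; auto.
  (* An operator of norm [0] vanishes everywhere, so the quotients are all [0]. *)
  - exists 0. intros eps Heps. exists 1. split; [lra|]. intros h Hh _.
    replace (op_add T (op_scal h S)) with T.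
    + replace ((opnorm T - opnorm T) / h - 0) with 0 by (field; exact Hh).
      rewrite Rabs_R0. exact Heps.
    + apply functional_extensionality. intros x. unfold op_add, op_scal.
      replace (S x) with (@ns_zero Y).
      * generalize (T x). intros y. vec y y y.
      * symmetry. apply ns_norm_eq0, Rle_antisym; [|apply ns_norm_nonneg].
        pose proof (opnorm_mult S x HS). rewrite <- H0 in H. lra.
Qed.

Theorem theorem3p9 (X Y : NormedSpace) (T : X -> Y) :
  banach X -> reflexive X -> kadets_klee X -> frechet_space Y ->
  compact_op T -> opnorm T = 1 ->
  (gateaux_diff_at (@bounded_linear X Y) op_add op_scal opnorm T <->
   frechet_diff_at (@bounded_linear X Y) op_add op_scal opnorm T).
Proof.
  intros _ Hrefl HKK HY HT HT1. split.
  - apply gateaux_frechet; assumption.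
  - apply frechet_gateaux.
Qed.
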